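(* Let $\mathcal{T}$ be a stacked component (with vertex set $\{0,1,\dots,2\,\mathrm{ord}(\ell)-1\}$ and edges as specified in the context), and let $d$ be its graph distance. Let $v,w\in V(\mathcal{T})$ be distinct vertices. If $2\nmid v$ and $2\nmid w$, then $$d(v,w)=\begin{cases}\frac12|v-w| & \text{if } |v-w|\le \mathrm{ord}(\ell)-1,\\ \mathrm{ord}(\ell)-\frac12|v-w| & \text{if } |v-w|\ge\mathrm{ord}(\ell)+1.\end{cases}$$ If $2\mid v$ and $2\nmid w$, then $d(v,w)=1+d(v+1,w)$; and if $2\mid v$ and $2\mid w$, then $d(v,w)=2+d(v+1,w+1)$.
   Context: Let $p$ be a prime with $p\equiv 71$ or $119\pmod{120}$, let $\ell=2$, and let $\mathrm{ord}(\ell)$ be the order, in the ideal class group of $\mathbb{Q}(\sqrt{-p})$, of a prime ideal above $2$; it is an odd integer $\ge 3$. A stacked component $\mathcal{T}$ (a component of the supersingular $2$-isogeny graph over $\mathbb{F}_p$ after identifying curves up to $\overline{\mathbb{F}_p}$-isomorphism, regarded as a simple undirected graph) is, writing $L=\mathrm{ord}(\ell)$, labelled so that $V(\mathcal{T})=\{0,1,\dots,2L-1\}$ and $$E(\mathcal{T})=\{\{2i,2i+1\}:0\le i\le L-1\}\cup\{\{2i+1,2i+3\}:0\le i\le L-2\}\cup\{\{2L-1,1\}\},$$ i.e. the odd vertices form a cycle and each even vertex $2i$ is a pendant vertex attached to $2i+1$. *)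

(* Defs.v *)
From HB Require Import structures.
From mathcomp Require Import all_boot all_order all_algebra all_field.
From mathcomp Require Import classical_sets.

Set Implicit Arguments.
Unset Strict Implicit.
Unset Printing Implicit Defensive.

Import GRing.Theory Num.Theory.

Local Open Scope classical_set_scope.
Local Open Scope ring_scope.

(* Q(sqrt(-p)), its ring of integers and its ideals are subsets of algC. *)
Definition quad_field (p : nat) : set algC :=
  [set x | exists a b : rat, x = ratr a + ratr b * sqrtC (- p%:R)].

Definition quad_int (p : nat) : set algC :=
  [set x | quad_field p x /\ x \in Aint].

Definition is_ideal (p : nat) (I : set algC) : Prop :=
  [/\ I `<=` quad_int p,
      I 0,
      forall x y, I x -> I y -> I (x + y)
    & forall a x, quad_int p a -> I x -> I (a * x)].

Definition is_prime_above (p l : nat) (P : set algC) : Prop :=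
  [/\ is_ideal p P,
      ~ P 1,
      forall x y, quad_int p x -> quad_int p y -> P (x * y) -> P x \/ P y
    & P l%:R].

Definition ideal_mul (I J : set algC) : set algC :=
  [set x | exists s : seq (algC * algC),
     (forall ab, ab \in s -> I ab.1 /\ J ab.2) /\
     x = \sum_(ab <- s) ab.1 * ab.2].

Definition ideal_exp (p : nat) (I : set algC) (n : nat) : set algC :=
  iter n (ideal_mul I) (quad_int p).

(* Equality of ideal classes: a I = b J for some nonzero integers a, b. *)
Definition same_class (p : nat) (I J : set algC) : Prop :=
  exists a b, [/\ quad_int p a, quad_int p b, a != 0, b != 0
    & [set a * x | x in I] = [set b * x | x in J]].

Definition is_class_order (p : nat) (I : set algC) (n : nat) : Prop :=
  [/\ (0 < n)%N,
      same_class p (ideal_exp p I n) (quad_int p)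
    & forall m, (0 < m < n)%N -> ~ same_class p (ideal_exp p I m) (quad_int p)].

Local Close Scope ring_scope.
Local Open Scope nat_scope.

Definition has_walk (T : finType) (e : rel T) (x y : T) (n : nat) : bool :=
  [exists s : n.-tuple T, path e x s && (last x s == y)].

(* The least length of a walk from x to y; shortest walks have length less than
   #|T|, so the value #|T| signals that x and y are not connected. *)
Definition graph_dist (T : finType) (e : rel T) (x y : T) : nat :=
  find (has_walk e x y) (iota 0 #|T|).

Definition stacked_edges (L : nat) : seq (nat * nat) :=
  [seq (2 * i, 2 * i + 1) | i <- iota 0 L] ++
  [seq (2 * i + 1, 2 * i + 3) | i <- iota 0 (L - 1)] ++
  [:: (2 * L - 1, 1)].

(* Edges are unordered, so each pair is taken in both directions. *)
Definition stacked_adj (L : nat) : rel 'I_(2 * L) := fun v w =>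
  ((v : nat, w : nat) \in stacked_edges L) ||
  ((w : nat, v : nat) \in stacked_edges L).

Definition stacked_dist (L : nat) (v w : 'I_(2 * L)) : nat :=
  graph_dist (@stacked_adj L) v w.

(* Main.v *)
Require Import Defs.
From mathcomp Require Import all_boot all_order all_algebra all_field.
From mathcomp Require Import classical_sets.
From mathcomp Require Import zify.

Set Implicit Arguments.
Unset Strict Implicit.
Unset Printing Implicit Defensive.

Import GRing.Theory.

(* The distance to a fixed vertex w is the only function vanishing at w that is
   1-Lipschitz along edges and strictly decreases along some edge at every other
   vertex. For v <> w the candidate is the distance in the cycle Z/L between
   v./2 and w./2, plus one for each even (pendant) endpoint. *)

Lemma has_walkP (T : finType) (e : rel T) (x y : T) (n : nat) :
  reflect (exists s : seq T, [/\ path e x s, last x s = y & size s = n])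
          (has_walk e x y n).
Proof.
apply: (iffP existsP) => [[s /andP[es /eqP ls]]|[s [es ls ss]]].
  by exists s; rewrite size_tuple.
by move/eqP: ss => ss; exists (Tuple ss); rewrite /= es ls eqxx.
Qed.

(** Each step of the walk lowers [D] by at most one. *)
Lemma walk_length_ge (T : finType) (e : rel T) (D : T -> nat) (x : T) (s : seq T) :
  (forall a b, e a b -> D a <= (D b).+1) ->
  path e x s -> D x <= D (last x s) + size s.
Proof.
move=> De; elim: s x => [|a s IH] x /=; first by rewrite addn0.
case/andP=> /De xa /IH; lia.
Qed.

(** Induction on the value of [D x]: value 0 forces [x] to be [y], since any other vertex has a
    neighbour whose value is one less. *)
Lemma descending_walk (T : finType) (e : rel T) (D : T -> nat) (x y : T) :
  D y = 0 ->
  (forall a, a != y -> exists2 b, e a b & D a = (D b).+1) ->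
  has_walk e x y (D x).
Proof.
move=> Dy Ddec; apply/has_walkP.
move En : (D x) => n; elim: n x En => [|n IH] x En.
  have [->|/Ddec[b _]] := eqVneq x y; first by exists [::].
  by rewrite En.
have [xy|/Ddec[b xb]] := eqVneq x y; first by rewrite xy Dy in En.
rewrite En => -[/esym /IH[s [bs ls ss]]].
by exists (b :: s); split=> //=; [rewrite xb | rewrite ss].
Qed.

(** [graph_dist] searches only lengths below [#|T|]: the bound on [D x] puts the descending walk in
    that range, and the Lipschitz condition excludes a shorter one. *)
Lemma graph_dist_eq (T : finType) (e : rel T) (D : T -> nat) (x y : T) :
  D y = 0 ->
  (forall a b, e a b -> D a <= (D b).+1) ->
  (forall a, a != y -> exists2 b, e a b & D a = (D b).+1) ->
  D x < #|T| ->
  graph_dist e x y = D x.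
Proof.
move=> Dy De Ddec Dx.
have walkD := @descending_walk T e D x y Dy Ddec.
have hasD : has (has_walk e x y) (iota 0 #|T|).
  by apply/hasP; exists (D x); rewrite // mem_iota.
have ltf : graph_dist e x y < #|T| by rewrite -[ltnRHS](size_iota 0) -has_find.
apply/eqP; rewrite eqn_leq; apply/andP; split.
  rewrite leqNgt; apply/negP => /(before_find 0).
  by rewrite nth_iota // add0n walkD.
have := nth_find 0 hasD; rewrite -/(graph_dist e x y) nth_iota // add0n.
case/has_walkP=> s [es ls <-].
by have := walk_length_ge De es; rewrite ls Dy.
Qed.

(** Truncation makes one of the two differences 0, so their sum is the absolute difference; the
    minimum is over the two arcs. *)
Definition cycle_dist (L i j : nat) : nat :=
  minn ((i - j) + (j - i)) (L - ((i - j) + (j - i))).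

(** Equal vertices need their own case: for [v] even the other branch would give 2. *)
Definition stacked_formula (L v w : nat) : nat :=
  if v == w then 0
  else cycle_dist L (v %/ 2) (w %/ 2) + (1 - v %% 2) + (1 - w %% 2).

Lemma stacked_formulaE (L i j r s : nat) : r < 2 -> s < 2 ->
  stacked_formula L (2 * i + r) (2 * j + s) =
  if (i == j) && (r == s) then 0 else cycle_dist L i j + (1 - r) + (1 - s).
Proof.
move=> lr ls; rewrite /stacked_formula.
have -> : (2 * i + r == 2 * j + s) = (i == j) && (r == s).
  by apply/eqP/andP => [?|[/eqP -> /eqP ->]] //; split; apply/eqP; lia.
have -> : (2 * i + r) %/ 2 = i by lia.
have -> : (2 * j + s) %/ 2 = j by lia.
have -> : (2 * i + r) %% 2 = r by lia.
by have -> : (2 * j + s) %% 2 = s by lia.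
Qed.

(* The summand 0 makes both cases instances of the left side of stacked_formulaE. *)
Lemma stacked_vertexP (L a : nat) : a < 2 * L ->
  exists i, i < L /\ (a = 2 * i + 0 \/ a = 2 * i + 1).
Proof. by move=> la; exists (a %/ 2); lia. Qed.

(** Endpoints take the shape that [stacked_formulaE] rewrites; [L = l.+1] removes the truncated
    subtraction from the closing edge. *)
Lemma stacked_edgesP (L a b : nat) :
  0 < L ->
  reflect [\/ exists2 i, i < L & a = 2 * i + 0 /\ b = 2 * i + 1,
              exists2 i, i.+1 < L & a = 2 * i + 1 /\ b = 2 * i.+1 + 1
            | exists2 l, L = l.+1 & a = 2 * l + 1 /\ b = 2 * 0 + 1]
          ((a, b) \in stacked_edges L).
Proof.
move=> L0; rewrite /stacked_edges !mem_cat; apply: (iffP or3P) => -[].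
- case/mapP=> i; rewrite mem_iota => iL [-> ->]; apply: Or31; exists i; lia.
- case/mapP=> i; rewrite mem_iota => iL [-> ->]; apply: Or32; exists i; lia.
- by rewrite inE => /eqP[-> ->]; apply: Or33; exists L.-1; lia.
- move=> [i iL [-> ->]]; apply: Or31; apply/mapP; exists i.
    by rewrite mem_iota.
  by rewrite addn0.
- move=> [i iL [-> ->]]; apply: Or32; apply/mapP; exists i.
    rewrite mem_iota; lia.
  congr (_, _); lia.
- move=> [l -> [-> ->]]; apply: Or33; rewrite inE; apply/eqP; congr (_, _); lia.
Qed.

(** Away from [w], a pendant edge changes only the parity summand and a cycle edge only
    [cycle_dist], each by at most one. *)
Lemma stacked_formula_edge (L a b w : nat) : w < 2 * L ->
  (a, b) \in stacked_edges L ->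
  stacked_formula L a w <= (stacked_formula L b w).+1 /\
  stacked_formula L b w <= (stacked_formula L a w).+1.
Proof.
move=> lw; have L0 : 0 < L by lia.
case: (stacked_vertexP lw) => j [jL wE] /(stacked_edgesP _ _ L0).
by case=> [[i iL [-> ->]]|[i iL [-> ->]]|[i iL [-> ->]]]; case: wE => ->;
  rewrite !stacked_formulaE // /cycle_dist; do ?case: eqP => ?; rewrite /=; lia.
Qed.

Lemma stacked_formula_descent (L a w : nat) : a < 2 * L -> w < 2 * L -> a <> w ->
  exists b, [/\ b < 2 * L,
    ((a, b) \in stacked_edges L) || ((b, a) \in stacked_edges L) &
    stacked_formula L a w = (stacked_formula L b w).+1].
Proof.
move=> la lw; have L0 : 0 < L by lia.
case: (stacked_vertexP la) => i [iL aE]; case: (stacked_vertexP lw) => j [jL wE].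
have pendant : (2 * i + 0, 2 * i + 1) \in stacked_edges L.
  by apply/(stacked_edgesP _ _ L0)/Or31; exists i.
have succ k : k.+1 < L -> (2 * k + 1, 2 * k.+1 + 1) \in stacked_edges L.
  by move=> kL; apply/(stacked_edgesP _ _ L0)/Or32; exists k.
have wrap : (2 * L.-1 + 1, 2 * 0 + 1) \in stacked_edges L.
  by apply/(stacked_edgesP _ _ L0)/Or33; exists L.-1; lia.
case: aE => -> aw.
  exists (2 * i + 1); rewrite pendant; split=> //; first by lia.
  case: wE aw => -> aw;
  rewrite !stacked_formulaE // /cycle_dist; do ?case: eqP => ?; rewrite /=; lia.
(* Here [a] is odd; if [i = j], then [w] is the pendant vertex attached to [a]. *)
have [ij|ij] := eqVneq i j.
  exists (2 * i + 0); rewrite pendant orbT; split=> //; first by lia.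
  case: wE aw => -> aw;
  rewrite !stacked_formulaE // /cycle_dist; do ?case: eqP => ?; rewrite /=; lia.
suff [k [kL edge kE]] : exists k, [/\ k < L,
    ((2 * i + 1, 2 * k + 1) \in stacked_edges L) ||
      ((2 * k + 1, 2 * i + 1) \in stacked_edges L)
    & cycle_dist L i j = (cycle_dist L k j).+1].
  exists (2 * k + 1); split=> //; first by lia.
  have [kj|kj] := eqVneq k j; move: kE; case: wE => ->;
  rewrite !stacked_formulaE // /cycle_dist; do ?case: eqP => ?; rewrite /=; lia.
(* Move along a shorter arc: the index goes up if [j] lies ahead within half a turn, or behind by at
   least half a turn. Either end of the index range uses the closing edge. *)
have [up|down] := boolP ((i < j) && (2 * (j - i) <= L) ||
                         (j < i) && (L <= 2 * (i - j))).
  have [last|] := eqVneq i L.-1.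
    by exists 0; rewrite last wrap; split=> //; rewrite /cycle_dist; lia.
  exists i.+1; rewrite succ; last lia.
  by split=> //; rewrite /cycle_dist; lia.
have [i0|ipos] := eqVneq i 0.
  by exists L.-1; rewrite i0 wrap orbT; split=> //; rewrite /cycle_dist; lia.
exists i.-1; have := succ i.-1; rewrite prednK ?lt0n // => -> //; rewrite orbT.
by split=> //; rewrite /cycle_dist; lia.
Qed.

Lemma stacked_distE (L : nat) (v w : 'I_(2 * L)) :
  stacked_dist v w = stacked_formula L v w.
Proof.
apply: (graph_dist_eq (D := fun a : 'I__ => stacked_formula L a w)) => /=.
- by rewrite /stacked_formula eqxx.
- by move=> a b /orP[] /(stacked_formula_edge (ltn_ord w))[].
- move=> a; rewrite -val_eqE => /eqP.
  by case/(stacked_formula_descent (ltn_ord a) (ltn_ord w)) => b [lb]; exists (Ordinal lb).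
(* The value is below [2 * L]: the cycle distance is at most half of [L] and the endpoints add at
   most 2; for [L = 1] two even endpoints coincide. *)
rewrite card_ord.
case: (stacked_vertexP (ltn_ord v)) (stacked_vertexP (ltn_ord w)) => i [iL vE] [j [jL wE]].
by case: vE => ->; case: wE => ->;
  rewrite stacked_formulaE // /cycle_dist; do ?case: eqP => ?; rewrite /=; lia.
Qed.

(* For v even, v + 1 < 2 * L, so ordS v (successor modulo 2 * L) is the vertex
   v + 1. *)
Theorem proposition29 (p : nat) (P : set algC) (L : nat)
    (hp : prime p) (hmod : p = 71 %[mod 120] \/ p = 119 %[mod 120])
    (hP : is_prime_above p 2 P) (hL : is_class_order p P L)
    (v w : 'I_(2 * L)) (hvw : v <> w) :
  [/\ ~~ (2 %| v) -> ~~ (2 %| w) ->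
        (`|(v : nat) - (w : nat)|%N <= L - 1 ->
           ((stacked_dist v w)%:R
              = 2^-1 * (`|(v : nat) - (w : nat)|%N)%:R :> rat)%R) /\
        (L + 1 <= `|(v : nat) - (w : nat)|%N ->
           ((stacked_dist v w)%:R
              = L%:R - 2^-1 * (`|(v : nat) - (w : nat)|%N)%:R :> rat)%R),
      2 %| v -> ~~ (2 %| w) ->
        stacked_dist v w = 1 + stacked_dist (ordS v) w
    & 2 %| v -> 2 %| w ->
        stacked_dist v w = 2 + stacked_dist (ordS v) (ordS w)].
Proof.
have ordS_even i (u : 'I_(2 * L)) : i < L -> u = 2 * i + 0 :> nat ->
    ordS u = 2 * i + 1 :> nat.
  by move=> iL /= ->; rewrite modn_small; lia.
have {hvw} vw : (v : nat) <> w by move/val_inj.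
case: (stacked_vertexP (ltn_ord v)) (stacked_vertexP (ltn_ord w)) => i [iL vE] [j [jL wE]].
rewrite !stacked_distE; split=> pv pw.
- have {}vE : v = 2 * i + 1 :> nat by lia.
  have {}wE : w = 2 * j + 1 :> nat by lia.
  have -> : stacked_formula L v w = cycle_dist L i j.
    by rewrite vE wE stacked_formulaE // /cycle_dist; do ?case: eqP => ?; rewrite /=; lia.
  have -> : absz (v%:Z - w%:Z)%R = 2 * absz (i%:Z - j%:Z)%R by lia.
  (* As [2 * |i - j|] is at most [L - 1] or at least [L + 1], the hypothesis decides which arc
     attains the minimum. *)
  split=> dvw.
    have -> : cycle_dist L i j = absz (i%:Z - j%:Z)%R by rewrite /cycle_dist; lia.
    by rewrite natrM mulKf.
  have -> : cycle_dist L i j = L - absz (i%:Z - j%:Z)%R by rewrite /cycle_dist; lia.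
  (* Since [|i - j| < L], the subtraction in [nat] is exact and passes to [rat]. *)
  by rewrite natrM mulKf // natrB //; lia.
- have {}vE : v = 2 * i + 0 :> nat by lia.
  have {}wE : w = 2 * j + 1 :> nat by lia.
  rewrite (ordS_even i v) // vE wE !stacked_formulaE // /cycle_dist.
  by do ?case: eqP => ?; rewrite /=; lia.
have {}vE : v = 2 * i + 0 :> nat by lia.
have {}wE : w = 2 * j + 0 :> nat by lia.
(* Distinct even vertices have [i <> j], so neither side falls into the zero branch. *)
rewrite (ordS_even i v) // (ordS_even j w) // vE wE !stacked_formulaE // /cycle_dist.
by do ?case: eqP => ?; rewrite /=; lia.
Qed.
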